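(* Let $R$ be a $k$-ary Boolean relation that is not balanced. Then there exists $u\in\{0,1\}^k\setminus R$ such that no polynomial $p_u$ of degree at most $1$ over any ring $E$ captures $u$ with respect to $R$.
   Context: A partial Boolean operation $f$ of arity $k$ is balanced if there are integers $\alpha_1,\ldots,\alpha_k$ with $\sum\alpha_i=1$ such that $(x_1,\ldots,x_k)$ is in its domain iff $\sum\alpha_ix_i\in\{0,1\}$, and then $f(x)=\sum\alpha_ix_i$. $f$ preserves $T\subseteq\{0,1\}^m$ if for all $t^1,\ldots,t^k\in T$, whenever the coordinatewise application of $f$ is defined in every coordinate, the result lies in $T$. A relation is balanced if preserved by all balanced operations. A polynomial $p_u$ in $k$ variables over a ring $E$ captures $u\in\{0,1\}^k\setminus R$ with respect to $R$ if, evaluated over $E$, $p_u(x)=0$ for all $x\in R$ and $p_u(u)\neq0$. *)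

(* Defs.v *)
From HB Require Import structures.
From mathcomp Require Import all_boot all_order all_algebra.
From mathcomp Require Import mpoly.

Set Implicit Arguments.
Unset Strict Implicit.
Unset Printing Implicit Defensive.

Import GRing.Theory.
Local Open Scope ring_scope.

(* Bit vectors, i.e. elements of {0,1}^k, with false read as 0, true as 1. *)
Definition bitvec (k : nat) := {ffun 'I_k -> bool}.

Definition boolrel (k : nat) := {set bitvec k}.

(* [f x = None] means that [x] lies outside the domain of [f]. *)
Definition partial_op (n : nat) := bitvec n -> option bool.

Definition comb (n : nat) (alpha : 'I_n -> int) (x : bitvec n) : int :=
  \sum_(i < n) alpha i * (x i)%:R.

(* No arity bound is needed: the coefficients sum to 1, so 0 < n. *)
Definition balanced_op (n : nat) (f : partial_op n) : Prop :=
  exists alpha : 'I_n -> int,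
    \sum_(i < n) alpha i = 1 /\
    forall x : bitvec n,
      (isSome (f x) <-> comb alpha x = 0 \/ comb alpha x = 1) /\
      (forall b : bool, f x = Some b -> comb alpha x = b%:R).

Definition preserves (n m : nat) (f : partial_op n) (T : boolrel m) : Prop :=
  forall t : 'I_n -> bitvec m,
    (forall i, t i \in T) ->
    forall s : bitvec m,
      (forall j : 'I_m, f [ffun i => t i j] = Some (s j)) ->
      s \in T.

Definition balanced (m : nat) (T : boolrel m) : Prop :=
  forall (n : nat) (f : partial_op n), balanced_op f -> preserves f T.

Definition bits_in (E : nzRingType) (k : nat) (x : bitvec k) : 'I_k -> E :=
  fun i => (x i)%:R.

(* Rings are unital, not necessarily commutative. Over the zero ring, excluded by
   [nzRingType], nothing is captured since [p(u) <> 0] cannot hold. *)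
Definition captures (E : nzRingType) (k : nat) (R : boolrel k)
    (u : bitvec k) (p : {mpoly E[k]}) : Prop :=
  (forall x : bitvec k, x \in R -> p.@[bits_in E x] = 0) /\
  p.@[bits_in E u] != 0.

(* [msize p] is the total degree plus one, and 0 for the zero polynomial. *)
Definition mdegree_le (E : nzRingType) (k : nat) (p : {mpoly E[k]}) (d : nat)
    : Prop :=
  (msize p <= d.+1)%N.

(* Main.v *)
Require Import Defs.
From mathcomp Require Import all_boot all_order all_algebra.
From mathcomp Require Import mpoly.
From Stdlib Require Import Classical.

(** A witness that [R] is not balanced is a tuple [u] outside [R] that is an
    affine integer combination of members of [R].  A polynomial of degree at
    most 1 commutes with affine integer combinations, since integers are central
    in every ring, so one that vanishes on [R] vanishes at [u]. *)

Import GRing.Theory.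
Local Open Scope ring_scope.

(** Wherever a balanced operation is defined, its value is the affine combination of its arguments.
    Applied coordinatewise to tuples of [R] it therefore yields such a combination, which a failure
    of preservation places outside [R]. *)
Lemma not_balanced_affine (k : nat) (R : boolrel k) :
  ~ balanced R ->
  exists (n : nat) (alpha : 'I_n -> int) (t : 'I_n -> bitvec k) (u : bitvec k),
    [/\ \sum_i alpha i = 1, forall i, t i \in R, u \notin R &
        forall j, (u j)%:R = \sum_i alpha i * (t i j)%:R].
Proof.
move=> hR; apply: NNPP => no_comb; apply: hR => n f [alpha [sum1 domf]] t tR u fu.
apply: contraPT isT => uR _; apply: no_comb; exists n, alpha, t, u; split=> // j.
rewrite -(proj2 (domf _) _ (fu j)).
by apply: eq_bigr => i _; rewrite ffunE.
Qed.

(** Degree at most 1 leaves a single variable, where the claim is [comb_u] cast into [E], or the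
    constant 1, where it is [sum1] cast into [E]. *)
Lemma monomial_affine (E : nzRingType) (k n : nat) (alpha : 'I_n -> int)
    (t : 'I_n -> bitvec k) (u : bitvec k) (m : 'X_{1..k}) :
  \sum_i alpha i = 1 ->
  (forall j, (u j)%:R = \sum_i alpha i * (t i j)%:R) ->
  (mdeg m <= 1)%N ->
  \prod_j bits_in E u j ^+ m j =
    \sum_i (\prod_j bits_in E (t i) j ^+ m j) *~ alpha i.
Proof.
move=> sum1 comb_u; rewrite leq_eqVlt ltnS leqn0 mdeg_eq0.
have prodU (x : bitvec k) j : \prod_l bits_in E x l ^+ U_(j)%MM l = (x j)%:R.
  rewrite (eq_bigr (fun l => if l == j then (x j)%:R else 1)) => [|l _].
    by rewrite -big_mkcond big_pred1_eq.
  by rewrite mnm1E eq_sym; case: eqP => [->|].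
case/orP=> [/mdeg1P[j /eqP->]|/eqP->].
  rewrite prodU; under eq_bigr do rewrite prodU.
  have /(congr1 (fun z : int => z%:~R : E)) := comb_u j.
  rewrite rmorph_nat rmorph_sum => ->; apply: eq_bigr => i _.
  by rewrite rmorphM rmorph_nat mulrzl.
have prod0 (x : bitvec k) : \prod_j bits_in E x j ^+ (0%MM : 'X_{1..k}) j = 1.
  by apply: big1 => j _; rewrite mnm0E.
rewrite prod0; under eq_bigr do rewrite prod0.
by rewrite -rmorph_sum sum1.
Qed.

(** By linearity the claim reduces to the monomials of [p]: integer weights move past the
    coefficients even when [E] is not commutative. *)
Lemma meval_affine (E : nzRingType) (k n : nat) (alpha : 'I_n -> int)
    (t : 'I_n -> bitvec k) (u : bitvec k) (p : {mpoly E[k]}) :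
  \sum_i alpha i = 1 ->
  (forall j, (u j)%:R = \sum_i alpha i * (t i j)%:R) ->
  mdegree_le p 1 ->
  p.@[bits_in E u] = \sum_i p.@[bits_in E (t i)] *~ alpha i.
Proof.
move=> sum1 comb_u deg_p; rewrite mevalE.
under [RHS]eq_bigr do rewrite mevalE -mulrzl mulr_sumr.
rewrite exchange_big; apply: eq_big_seq => m /msize_mdeg_lt m_p.
rewrite (monomial_affine _ _ _ _ _ _ _ sum1 comb_u) ?mulr_sumr; last first.
  (* [mdeg m] is strictly below [msize p], which is at most 2. *)
  by rewrite -ltnS (leq_trans m_p).
by apply: eq_bigr => i _; rewrite mulrzl mulrzAr.
Qed.

Theorem theorem4p4 (k : nat) (R : boolrel k) (hR : ~ balanced R) :
  exists u : bitvec k,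
    u \notin R /\
    forall (E : nzRingType) (p : {mpoly E[k]}),
      mdegree_le p 1 -> ~ captures R u p.
Proof.
have [n [alpha [t [u [sum1 tR uR comb_u]]]]] := not_balanced_affine _ _ hR.
exists u; split=> // E p deg_p [p_R /eqP[]].
rewrite (meval_affine _ _ _ _ _ _ _ sum1 comb_u deg_p).
by apply: big1 => i _; rewrite p_R ?mul0rz.
Qed.
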